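(* Let $A$ be a Noetherian integral domain with field of fractions $K$, let $M$ be a finitely generated torsion-free $A$-module, and put $V=K\otimes_A M$, assumed of dimension $n\ge 2$ over $K$. Let $G^*(M)$ be the poset, ordered by inclusion, of pure submodules $N\subseteq M$ with $N\neq 0$ and $N\neq M$. Let $\mathcal{S}^*(M)$ be the poset, ordered by inclusion, of nonempty finite subsets $Y\subseteq M\setminus\{0\}$ whose rank (the $K$-dimension of the subspace of $V$ spanned by $Y$) is $<n$. Then the order-preserving map \[\operatorname{AR}:\mathcal{S}^*(M)\to G^*(M),\qquad Y\mapsto \langle Y\rangle_{\mathrm{sat}},\] sending $Y$ to the saturation of the submodule generated by $Y$, is a homotopy equivalence, i.e. it induces a homotopy equivalence between the geometric realisations of the nerves of these posets (viewed as categories).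
   Context: A submodule $N\subseteq M$ is pure if $M/N$ is torsion-free. The saturation $P_{\mathrm{sat}}$ of a submodule $P\subseteq M$ is the smallest pure submodule of $M$ containing $P$, namely the kernel of $M\to M/P\to (M/P)/\text{torsion}$. Equivalently, $\mathcal{S}^*(M)$ is the poset of simplices of the simplicial complex $E^*(M)$ whose simplices are the nonempty finite subsets of $M\setminus\{0\}$ of rank $<n$. *)

(* Defs.v *)
From HB Require Import structures.
From mathcomp Require Import all_boot all_order all_algebra.
From mathcomp Require Import finmap.
From Stdlib Require List.
From mathcomp Require Import all_classical all_reals all_analysis.
Set Implicit Arguments. Unset Strict Implicit. Unset Printing Implicit Defensive.
Import Order.TTheory GRing.Theory Num.Theory.
Import numFieldTopology.Exports numFieldNormedType.Exports.
Local Open Scope classical_set_scope.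
Local Open Scope ring_scope.

Section Alg.
Variable A : idomainType.

Definition is_ideal (I : set A) : Prop :=
  I 0 /\ (forall a b, I a -> I b -> I (a + b)) /\ (forall r a, I a -> I (r * a)).

Definition noetherian : Prop :=
  forall I : set A, is_ideal I ->
    exists l : seq A, I = [set a | exists c : 'I_(size l) -> A,
                                   a = \sum_(i < size l) c i * l`_i].

Variable M : lmodType A.

Definition fin_gen_module : Prop :=
  exists l : seq M, forall m : M, exists c : 'I_(size l) -> A,
    m = \sum_(i < size l) c i *: l`_i.

Definition torsion_free : Prop :=
  forall (a : A) (m : M), a *: m = 0 -> a = 0 \/ m = 0.

Definition submodule (N : set M) : Prop :=
  N 0 /\ (forall x y, N x -> N y -> N (x + y)) /\ (forall a x, N x -> N (a *: x)).

(* N pure <-> M/N torsion-free *)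
Definition pure (N : set M) : Prop :=
  submodule N /\ forall (a : A) (m : M), a != 0 -> N (a *: m) -> N m.

Definition span_fset (Y : {fset M}) : set M :=
  [set m | exists c : M -> A, m = \sum_(y <- enum_fset Y) c y *: y].

(* saturation: kernel of M -> M/P -> (M/P)/torsion *)
Definition saturation (P : set M) : set M :=
  [set m | exists a : A, a != 0 /\ P (a *: m)].

Definition lin_indep (l : seq M) : Prop :=
  forall c : 'I_(size l) -> A,
    \sum_(i < size l) c i *: l`_i = 0 -> forall i, c i = 0.

(* rank (= K-dimension of the K-span in V = K (x)_A M) of a subset S of M:
   the maximal size of an A-linearly independent family in S. *)
Definition has_rank (S : set M) (n : nat) : Prop :=
  (exists l : seq M, {subset l <= S} /\ lin_indep l /\ size l = n) /\
  (forall l : seq M, {subset l <= S} -> lin_indep l -> (size l <= n)%N).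

Definition rank_lt (S : set M) (n : nat) : Prop :=
  forall l : seq M, {subset l <= S} -> lin_indep l -> (size l < n)%N.

Definition Gstar (N : set M) : Prop := pure N /\ N <> [set 0] /\ N <> setT.

Definition Sstar (n : nat) (Y : {fset M}) : Prop :=
  Y != fset0 /\ 0 \notin Y /\ rank_lt [set y | y \in Y] n.

Definition AR (Y : {fset M}) : set M := saturation (span_fset Y).
End Alg.

Section Realisation.
Variable R : realType.

Definition std_simplex (k : nat) : set 'rV[R]_k :=
  [set t | (forall i, 0 <= t 0 i) /\ \sum_(i < k) t 0 i = 1].

Arguments std_simplex : clear implicits.

Definition unit_int : set R := [set s | 0 <= s <= 1].

Definition rel_open {X : topologicalType} (D S : set X) : Prop :=
  exists O : set X, open O /\ S = O `&` D.

Variable T : Type.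
Variable le : T -> T -> Prop.

Definition is_chain (c : seq T) : Prop :=
  forall p q, List.In p c -> List.In q c -> le p q \/ le q p.

(* the point of |P| with barycentric coordinates t on the simplex c *)
Definition simpl_pt (c : seq T) (t : 'rV[R]_(size c)) : T -> R :=
  fun p => \sum_(i < size c) (if `[< p = nth p c i >] then t 0 i else 0).

Arguments simpl_pt : clear implicits.

Definition supported (x : T -> R) (c : seq T) : Prop :=
  forall p, x p != 0 -> List.In p c.

Definition real_pt (x : T -> R) : Prop :=
  (forall p, 0 <= x p) /\
  exists c : seq T, List.NoDup c /\ is_chain c /\ supported x c /\
                    \sum_(p <- c) x p = 1.

(* weak topology: U open iff its trace on every closed simplex is open *)
Definition real_open (U : set (T -> R)) : Prop :=
  U `<=` real_pt /\
  forall c : seq T, List.NoDup c -> is_chain c ->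
    rel_open (std_simplex (size c)) (std_simplex (size c) `&` (simpl_pt c @^-1` U)).

(* topology on |P| x [0,1] (= weak topology w.r.t. the sigma x [0,1]) *)
Definition realI_open (W : set ((T -> R) * R)) : Prop :=
  W `<=` (fun xs => real_pt xs.1 /\ unit_int xs.2) /\
  forall c : seq T, List.NoDup c -> is_chain c ->
    rel_open (std_simplex (size c) `*` unit_int)
      [set ts | std_simplex (size c) ts.1 /\ unit_int ts.2 /\
                W (simpl_pt c ts.1, ts.2)].
End Realisation.

Section Maps.
Variable R : realType.
Variables (T1 T2 : Type) (le1 : T1 -> T1 -> Prop) (le2 : T2 -> T2 -> Prop).

Definition real_cont (f : (T1 -> R) -> (T2 -> R)) : Prop :=
  (forall x, real_pt le1 x -> real_pt le2 (f x)) /\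
  forall V, real_open le2 V -> real_open le1 (real_pt le1 `&` (f @^-1` V)).

Definition realI_cont (H : (T1 -> R) * R -> (T2 -> R)) : Prop :=
  (forall xs, real_pt le1 xs.1 -> unit_int xs.2 -> real_pt le2 (H xs)) /\
  forall V, real_open le2 V ->
    realI_open le1 ((fun xs => real_pt le1 xs.1 /\ unit_int xs.2) `&` (H @^-1` V)).

Definition real_homotopic (f g : (T1 -> R) -> (T2 -> R)) : Prop :=
  exists H : (T1 -> R) * R -> (T2 -> R), realI_cont H /\
    forall x, real_pt le1 x -> H (x, 0) = f x /\ H (x, 1) = g x.

(* F is the map |f| induced on realisations by f : T1 -> T2, where the
   map f is given as a relation "f p = q" (decidable classically). *)
Definition realises (feq : T1 -> T2 -> Prop) (F : (T1 -> R) -> (T2 -> R)) : Prop :=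
  forall x, real_pt le1 x -> forall c, List.NoDup c -> supported x c ->
    forall q, F x q = \sum_(p <- c) (if `[< feq p q >] then x p else 0).
End Maps.

Definition real_homotopy_equiv (R : realType) (T1 T2 : Type)
  (le1 : T1 -> T1 -> Prop) (le2 : T2 -> T2 -> Prop)
  (F : (T1 -> R) -> (T2 -> R)) : Prop :=
  real_cont le1 le2 F /\
  exists G : (T2 -> R) -> (T1 -> R),
    real_cont le2 le1 G /\
    real_homotopic le1 le1 (fun x => G (F x)) id /\
    real_homotopic le2 le2 (fun y => F (G y)) id.

(* Main.v *)
(* A homotopy inverse of AR is written down explicitly. Choose a nonzero element m_N in every
   pure submodule N. A point y of |G*(M)| gives the probability vector w = sum_N y_N [m_N] on
   M, supported in the largest N occurring in y, and the superlevel sets of w form a chain of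
   finite subsets of rank < n; weighting them continuously gives a point G(y) of |S*(M)|.

   The composite G o AR is homotopic to the identity: moving the vector w attached to AR(x)
   linearly to the barycentre b(x) = sum_Y x_Y (uniform measure on Y) stays inside the largest
   saturation AR(Y) with x_Y > 0, and the superlevel sets of b(x) all belong to the chain of x.

   For AR o G, split y at its median into a lower and an upper half. All submodules in the
   support of AR(G(lower y)) lie below those of upper y, so there are straight-line homotopies
   AR o G o lower ~ upper ~ id, and AR o G o lower ~ AR o G because lower ~ id.

   Purity enters through two facts: a proper pure submodule has rank < n, and saturation does
   not increase the rank. *)
Require Import Defs.
From HB Require Import structures.
From mathcomp Require Import all_boot all_order all_algebra.
From mathcomp Require Import finmap.
From Stdlib Require List.
From mathcomp Require Import all_classical all_reals all_analysis.
From mathcomp Require Import ring lra.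
Import Order.TTheory GRing.Theory Num.Theory.
Import numFieldTopology.Exports numFieldNormedType.Exports.
Local Open Scope classical_set_scope.
Local Open Scope ring_scope.
Set Implicit Arguments. Unset Strict Implicit. Unset Printing Implicit Defensive.

(** * Points of the realisation and continuity on simplices *)

Lemma proj1_sig_inj (U : Type) (Q : U -> Prop) (a b : {x | Q x}) :
  proj1_sig a = proj1_sig b -> a = b.
Proof. by case: a b => a Qa [b Qb] /= ab; exact: eq_exist. Qed.

Section FinitelySupported.
Variables (R : realType) (T : choiceType).
Implicit Types (x y : T -> R) (d : seq T).

Definition supp_in x d := forall p, x p != 0 -> p \in d.

(** Summing over the whole type avoids carrying an enumeration of the support; any list containing
    the support computes the sum once duplicates are removed. *)
Definition fsum x : R := \sum_(p \in [set: T]) x p.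

Lemma fsumE x d : uniq d -> supp_in x d -> fsum x = \sum_(p <- d) x p.
Proof.
move=> du xd; rewrite /fsum (fsbig_seq _ _ du); apply/esym/fsbig_widen => // p [_ pd] /=.
by apply/eqP; apply: contra_notT pd => /xd.
Qed.

Lemma fsumE_undup x d : supp_in x d -> fsum x = \sum_(p <- undup d) x p.
Proof. by move=> xd; apply: fsumE (undup_uniq d) _ => p /xd; rewrite mem_undup. Qed.

Lemma fsum_ge0 x : (forall p, 0 <= x p) -> 0 <= fsum x.
Proof. by move=> x0; apply: fsumr_ge0. Qed.

Lemma fsum_gt0 x d p : supp_in x d -> (forall p, 0 <= x p) -> x p != 0 -> 0 < fsum x.
Proof.
move=> xd x0 xp; rewrite (fsumE_undup xd) (big_rem p) ?mem_undup ?xd//=.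
by rewrite ltr_pwDl ?sumr_ge0// lt_neqAle eq_sym xp x0.
Qed.

Lemma fsumD x y d : supp_in x d -> supp_in y d -> fsum (fun p => x p + y p) = fsum x + fsum y.
Proof.
move=> xd yd; rewrite (fsumE_undup xd) (fsumE_undup yd) -big_split/=.
apply: fsumE_undup => p; have [-> | /xd//] := eqVneq (x p) 0.
by rewrite add0r => /yd.
Qed.

Lemma fsumZ a x d : supp_in x d -> fsum (fun p => a * x p) = a * fsum x.
Proof.
move=> xd; rewrite (fsumE_undup xd) mulr_sumr; apply: fsumE_undup => p.
by rewrite mulf_eq0 negb_or => /andP[_ /xd].
Qed.

Lemma fsum_neq0 x : fsum x != 0 -> exists p, x p != 0.
Proof.
move=> x0; apply: contrapT => /forallNP x0'; case/negP: x0; apply/eqP.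
by apply: fsbig1 => p _; apply/eqP; apply: contrapT => /negP/x0'.
Qed.

Lemma ler_fsum x y d : supp_in x d -> supp_in y d -> (forall p, x p <= y p) -> fsum x <= fsum y.
Proof.
by move=> xd yd xy; rewrite (fsumE_undup xd) (fsumE_undup yd) ler_sum.
Qed.

Definition normalise x : T -> R := fun p => x p / fsum x.

End FinitelySupported.

Lemma InP (T : eqType) (p : T) (c : seq T) : List.In p c <-> p \in c.
Proof.
elim: c => //= q c IH; rewrite in_cons; split=> [[->|/IH->]|/orP[/eqP->|/IH]]; rewrite ?eqxx ?orbT//.
- by left.
- by right.
Qed.

Lemma NoDupP (T : eqType) (c : seq T) : List.NoDup c <-> uniq c.
Proof.
elim: c => [|p c IH] /=; first by split=> // _; exact: List.NoDup_nil.
split=> [/List.NoDup_cons_iff[pc /IH->]|/andP[pc /IH cu]].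
  by rewrite andbT; apply/negP => /InP.
by apply: List.NoDup_cons => // /InP; exact/negP.
Qed.

Section Points.
Variables (R : realType) (T : choiceType) (le : T -> T -> Prop).
Implicit Types (x : T -> R).

(** The enumerating chain is traded for conditions on the support itself, so [d] may have
    repetitions or incomparable entries: the support, filtered out of [undup d], is again a
    duplicate-free chain. *)
Lemma real_ptP x : real_pt le x <->
  [/\ (forall p, 0 <= x p), (exists d, supp_in x d),
      (forall p q, x p != 0 -> x q != 0 -> le p q \/ le q p) & fsum x = 1].
Proof.
split=> [[x0 [c [/NoDupP cu [cc [xc x1]]]]]|[x0 [d xd] xch x1]].
  have xc' : supp_in x c by move=> p /xc /InP.
  split=> //; first by exists c.
    by move=> p q xp xq; apply: cc; apply: xc.
  by rewrite (fsumE cu).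
split=> //; exists [seq p <- undup d | x p != 0].
have cu : uniq [seq p <- undup d | x p != 0] by rewrite filter_uniq ?undup_uniq.
have xsub : supp_in x [seq p <- undup d | x p != 0].
  by move=> p xp; rewrite mem_filter xp mem_undup xd.
split; first exact/NoDupP.
split; first by move=> p q /InP + /InP; rewrite !mem_filter => /andP[+ _] /andP[+ _]; exact: xch.
by split; [move=> p /xsub /InP | rewrite -(fsumE cu)].
Qed.

Lemma real_pt_neq0 x : real_pt le x -> exists p, x p != 0.
Proof. by case/real_ptP=> _ _ _ x1; apply: fsum_neq0; rewrite x1 oner_neq0. Qed.

Lemma simpl_ptE (c : seq T) (t : 'rV[R]_(size c)) (i : 'I_(size c)) p0 :
  uniq c -> simpl_pt t (nth p0 c i) = t 0 i.
Proof.
move=> cu; rewrite /simpl_pt (bigD1 i)//= big1 ?addr0 => [|j ji].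
  by rewrite (set_nth_default p0)//; case: asboolP.
case: asboolP => // /eqP; rewrite (set_nth_default p0 (nth p0 c i))// nth_uniq//.
by move=> /eqP/val_inj ij; rewrite ij eqxx in ji.
Qed.

Lemma simpl_pt_supp (c : seq T) (t : 'rV[R]_(size c)) : supp_in (simpl_pt t) c.
Proof.
move=> p; apply: contraNT => pc; rewrite /simpl_pt big1// => i _.
by case: asboolP => // pE; rewrite pE mem_nth in pc.
Qed.

Lemma simpl_pt_sum (c : seq T) (t : 'rV[R]_(size c)) :
  uniq c -> fsum (simpl_pt t) = \sum_(i < size c) t 0 i.
Proof.
case: c t => [|p0 c] t cu; first by rewrite (fsumE cu (@simpl_pt_supp _ _)) big_nil big_ord0.
rewrite (fsumE cu (@simpl_pt_supp _ _)) (big_nth p0) big_mkord.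
by apply: eq_bigr => i _; rewrite simpl_ptE.
Qed.

Lemma simpl_pt_real (c : seq T) (t : 'rV[R]_(size c)) :
  uniq c -> is_chain le c -> @std_simplex R (size c) t -> real_pt le (simpl_pt t).
Proof.
move=> cu cc [t0 t1]; apply/real_ptP; split.
- by move=> p; apply: sumr_ge0 => i _; case: ifP.
- by exists c; exact: simpl_pt_supp.
- by move=> p q /simpl_pt_supp/InP + /simpl_pt_supp/InP; exact: cc.
- by rewrite simpl_pt_sum.
Qed.

Lemma simpl_pt_coords (c : seq T) x : uniq c -> real_pt le x -> supp_in x c ->
  let t := \row_(i < size c) x (tnth (in_tuple c) i) in
  @std_simplex R (size c) t /\ simpl_pt t = x.
Proof.
move=> cu /real_ptP[x0 _ _ x1] xc t; split; first split.
- by move=> i; rewrite mxE.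
- rewrite -x1 (fsumE cu xc) (big_tnth _ _ c); apply: eq_bigr => i _; by rewrite mxE.
- apply/funext => p; have [pc|pc] := boolP (p \in c); last first.
    have /eqP -> : simpl_pt t p == 0 by apply: contraNT pc => /simpl_pt_supp.
    by apply/esym/eqP; apply: contraNT pc => /xc.
  have i0 : (index p c < size c)%N by rewrite index_mem.
  rewrite -[X in simpl_pt _ X](nth_index p pc) -[index p c]/(val (Ordinal i0)).
  by rewrite simpl_ptE// mxE (tnth_nth p)/= nth_index.
Qed.

End Points.

(** * Continuity relative to a subset *)

Section ContinuousOn.
Variables (R : realType) (X : topologicalType) (D : set X).
Implicit Types f g : X -> R.

Definition cont_on f := forall z, D z -> f x @[x --> within D (nbhs z)] --> f z.

Lemma cont_on_ext f g : (forall z, D z -> f z = g z) -> cont_on f -> cont_on g.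
Proof.
move=> fg cf z Dz; rewrite -fg//; apply: cvg_trans (cf z Dz); apply: near_eq_cvg.
by rewrite near_withinE; near=> y => Dy; rewrite fg.
Unshelve. all: end_near. Qed.

Lemma cont_on_cst a : cont_on (fun=> a).
Proof. by move=> z _; exact: cvg_cst. Qed.

Lemma cont_on_continuous f : continuous f -> cont_on f.
Proof. by move=> cf z _; apply: cvg_within_filter; exact: cf. Qed.

Lemma cont_onD f g : cont_on f -> cont_on g -> cont_on (fun z => f z + g z).
Proof. by move=> cf cg z Dz; apply: cvgD; [exact: cf|exact: cg]. Qed.

Lemma cont_onB f g : cont_on f -> cont_on g -> cont_on (fun z => f z - g z).
Proof. by move=> cf cg z Dz; apply: cvgB; [exact: cf|exact: cg]. Qed.

Lemma cont_onM f g : cont_on f -> cont_on g -> cont_on (fun z => f z * g z).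
Proof. by move=> cf cg z Dz; apply: cvgM; [exact: cf|exact: cg]. Qed.

Lemma cont_onV f : (forall z, D z -> f z != 0) -> cont_on f -> cont_on (fun z => (f z)^-1).
Proof. by move=> f0 cf z Dz; apply: cvgV; [exact: f0|exact: cf]. Qed.

Lemma cont_on_max0 f : cont_on f -> cont_on (fun z => Num.max 0 (f z)).
Proof.
move=> cf z Dz; have -> : (fun z => Num.max 0 (f z)) = (fun z => 2^-1 * (f z + `|f z|)).
  by apply/funext => y; rewrite maxr_absE sub0r normrN add0r mulrC.
have -> : Num.max 0 (f z) = 2^-1 * (f z + `|f z|).
  by rewrite maxr_absE sub0r normrN add0r mulrC.
apply: cvgM; first exact: cvg_cst.
by apply: cvgD; [exact: cf|apply: cvg_norm; exact: cf].
Qed.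

Lemma cont_on_sum (I : Type) (s : seq I) (F : I -> X -> R) :
  (forall i, cont_on (F i)) -> cont_on (fun z => \sum_(i <- s) F i z).
Proof.
move=> cF; elim: s => [|i s IH].
  by apply: (cont_on_ext _ (@cont_on_cst 0)) => z _; rewrite big_nil.
by apply: (cont_on_ext _ (cont_onD (cF i) IH)) => z _; rewrite big_cons.
Qed.

Lemma cont_on_prod (I : Type) (s : seq I) (F : I -> X -> R) :
  (forall i, cont_on (F i)) -> cont_on (fun z => \prod_(i <- s) F i z).
Proof.
move=> cF; elim: s => [|i s IH].
  by apply: (cont_on_ext _ (@cont_on_cst 1)) => z _; rewrite big_nil.
by apply: (cont_on_ext _ (cont_onM (cF i) IH)) => z _; rewrite big_cons.
Qed.

Lemma rel_openP (S : set X) : S `<=` D ->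
  rel_open D S <-> forall z, S z -> within D (nbhs z) S.
Proof.
move=> SD; split=> [[U [Uo SE]] z|SO].
  rewrite SE => -[Uz Dz]; have : nbhs z U by exact: open_nbhs_nbhs.
  by apply: filterS => y Oy Dy.
(* This is the largest open set whose trace on [D] lies in [S]. *)
exists (interior (S `|` ~` D)); split; first exact: open_interior.
apply/seteqP; split=> [z Sz|z [/interior_subset [] //]].
split; last exact: SD.
change (nbhs z (S `|` ~` D)); have := SO z Sz; rewrite /within/=; apply: filterS => y Sy.
by have [Dy|] := pselect (D y); [left; exact: Sy|right].
Qed.

Lemma cont_on_open f (O : set R) : cont_on f -> open O -> rel_open D (D `&` f @^-1` O).
Proof.
move=> cf Oo; apply/rel_openP => [z []//|z [Dz Oz]].
have := cf z Dz _ (open_nbhs_nbhs (conj Oo Oz)); rewrite /nbhs/= /within/=.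
by apply: filterS => y + Dy => /(_ Dy).
Qed.

End ContinuousOn.

Lemma cont_on_comp (R : realType) (X Y : topologicalType) (D : set X) (E : set Y)
    (h : X -> Y) (f : Y -> R) :
  continuous h -> (forall z, D z -> E (h z)) -> cont_on E f -> cont_on D (f \o h).
Proof.
move=> ch hDE cf z Dz; apply: (@cvg_comp _ _ _ _ _ _ (within E (nbhs (h z)))); last exact/cf/hDE.
move=> A; rewrite /within/= => EA; have := ch z _ EA; rewrite /nbhs/=.
by apply: filterS => y + Dy; apply; exact: hDE.
Qed.

(** * Maps and homotopies given by coordinates *)

Section Families.
Variable R : realType.
Implicit Types X Y : topologicalType.

(** A single finite support valid on all of [D] reduces continuity into the weak topology to
    continuity of coordinates; this is the condition checked on each closed simplex for maps and
    homotopies. *)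
Definition fam X (D : set X) (T : choiceType) (Phi : X -> T -> R) :=
  (exists d, forall z, D z -> supp_in (Phi z) d) /\ (forall p, cont_on D (Phi ^~ p)).

Lemma fam_comp X Y (D : set X) (E : set Y) (T : choiceType) (h : X -> Y) (Phi : Y -> T -> R) :
  continuous h -> (forall z, D z -> E (h z)) -> fam E Phi -> fam D (fun z => Phi (h z)).
Proof.
move=> ch hDE [[d dP] cP]; split; first by exists d => z Dz; exact/dP/hDE.
by move=> p; apply: cont_on_comp ch hDE (cP p).
Qed.

Lemma fam_weighted X (D : set X) (T : choiceType) (Phi : X -> T -> R) (a : T -> X -> R) :
  fam D Phi -> (forall p, cont_on D (a p)) -> fam D (fun z p => Phi z p * a p z).
Proof.
move=> [[d dP] cP] ca; split=> [|p]; last exact: cont_onM.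
by exists d => z Dz p; rewrite mulf_eq0 negb_or => /andP[+ _]; exact: dP.
Qed.

Lemma fam_add X (D : set X) (T : choiceType) (Phi Psi : X -> T -> R) :
  fam D Phi -> fam D Psi -> fam D (fun z p => Phi z p + Psi z p).
Proof.
move=> [[d dP] cP] [[e eP] cQ]; split=> [|p]; last exact: cont_onD.
exists (d ++ e) => z Dz p; rewrite mem_cat; have [-> | /(dP _ Dz) ->//] := eqVneq (Phi z p) 0.
by rewrite add0r => /(eP _ Dz) ->; rewrite orbT.
Qed.

Lemma fam_fsum X (D : set X) (T : choiceType) (Phi : X -> T -> R) :
  fam D Phi -> cont_on D (fun z => fsum (Phi z)).
Proof.
move=> [[d dP] cP]; apply: (cont_on_ext _ (cont_on_sum (s := undup d) cP)) => z Dz.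
by rewrite (fsumE_undup (dP _ Dz)).
Qed.

Lemma fam_fsum_weighted X (D : set X) (T : choiceType) (Phi : X -> T -> R) (a : T -> R) :
  fam D Phi -> cont_on D (fun z => fsum (fun p => Phi z p * a p)).
Proof.
by move=> fP; apply/fam_fsum/fam_weighted => // p; exact: cont_on_cst.
Qed.

Lemma fam_normalise X (D : set X) (T : choiceType) (Phi : X -> T -> R) :
  (forall z, D z -> (forall p, 0 <= Phi z p) /\ exists p, Phi z p != 0) ->
  fam D Phi -> fam D (fun z => normalise (Phi z)).
Proof.
move=> P0 fP; apply: fam_weighted => // _; apply: cont_onV; last exact: fam_fsum.
move=> z Dz; have [Pz [p Pp]] := P0 z Dz; have [[d dP] _] := fP.
by rewrite gt_eqF// (fsum_gt0 (dP _ Dz) Pz Pp).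
Qed.

End Families.

(** * Pushing vectors forward along a kernel *)

Section Pushforward.
Variables (R : realType) (T T' : choiceType) (k : T -> T' -> R).

(** When the rows [k p] are probability vectors, this is the affine extension of sending the vertex
    [p] to [k p]; it yields both induced simplicial maps ([indic]) and barycentres ([bary]). *)
Definition push (x : T -> R) : T' -> R := fun q => fsum (fun p => x p * k p q).

Lemma push_supp x q : push x q != 0 -> exists p, x p != 0 /\ k p q != 0.
Proof. by move=> /fsum_neq0[p]; rewrite mulf_eq0 negb_or => /andP[]; exists p. Qed.

Lemma push_ge0 x : (forall p q, 0 <= k p q) -> (forall p, 0 <= x p) -> forall q, 0 <= push x q.
Proof. by move=> k0 x0 q; apply: fsum_ge0 => p; rewrite mulr_ge0. Qed.

Variable kd : T -> seq T'.
Hypothesis kdP : forall p, supp_in (k p) (kd p).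

Lemma push_supp_in x d : supp_in x d -> supp_in (push x) (flatten (map kd d)).
Proof.
move=> xd q /push_supp[p [/xd pd /kdP qp]]; apply/flattenP; exists (kd p) => //.
exact: map_f.
Qed.

Lemma push_sum x d : (forall p, fsum (k p) = 1) -> supp_in x d -> fsum (push x) = fsum x.
Proof.
move=> k1 xd; rewrite (fsumE_undup (push_supp_in xd)) (fsumE_undup xd).
under eq_bigr => q _.
  rewrite /push (@fsumE_undup _ _ _ d); last first.
    by move=> p; rewrite mulf_eq0 negb_or => /andP[/xd].
  over.
rewrite exchange_big/= big_seq [RHS]big_seq; apply: eq_bigr => p; rewrite mem_undup => pd.
rewrite -mulr_sumr -fsumE_undup ?k1 ?mulr1// => q /kdP qp.
by apply/flattenP; exists (kd p) => //; exact: map_f.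
Qed.

Lemma fam_push (X : topologicalType) (D : set X) (Phi : X -> T -> R) :
  fam D Phi -> fam D (fun z => push (Phi z)).
Proof.
move=> fP; split; last by move=> q; exact: fam_fsum_weighted.
by have [[d dP] _] := fP; exists (flatten (map kd d)) => z Dz; exact/push_supp_in/dP.
Qed.

End Pushforward.

Lemma cvg_row (R : realType) (X : Type) (F : set_system X) (k : nat)
    (t : X -> 'rV[R]_k) (t0 : 'rV[R]_k) : Filter F ->
  (forall i, t y 0 i @[y --> F] --> t0 0 i) -> t @ F --> t0.
Proof.
move=> FF ct A [P nP PA]; apply: (@filterS _ F _ (fun y => forall i, P 0 i (t y 0 i))).
  by move=> y Py; apply: PA => i j; rewrite (ord1 i).
by apply: filter_forall => i; apply: ct; exact: nP.
Qed.

Section OpenPreimage.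
Variables (R : realType) (T : choiceType) (le : T -> T -> Prop).

(* Near a point, [Phi] only meets the finitely many closed simplices spanned by
   sublists of its common support, and on each of them it is read off coordinates. *)
Lemma fam_open_preimage (X : topologicalType) (D : set X) (Phi : X -> T -> R) V :
  fam D Phi -> (forall z, D z -> real_pt le (Phi z)) -> real_open le V ->
  rel_open D (D `&` Phi @^-1` V).
Proof.
move=> [[d' dP'] cP] rP [_ Vo]; pose d := undup d'.
have dP z : D z -> supp_in (Phi z) d by move=> Dz p /(dP' z Dz); rewrite mem_undup.
have du : uniq d := undup_uniq d'.
apply/rel_openP => [z []//|z [Dz Vz]].
(* Masks of [d] enumerate its sublists, hence finitely many candidate faces; each gets its own
   neighbourhood, and these are intersected at the end. *)
have loc (m : (size d).-tuple bool) : within D (nbhs z)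
    [set y | D y -> supp_in (Phi y) (mask m d) -> is_chain le (mask m d) -> V (Phi y)].
  set e := mask m d; have eu : uniq e by exact: mask_uniq.
  have [ec|nec] := pselect (is_chain le e); last by apply: filterE => y _ _ /nec.
  (* If [z] has a nonzero coordinate outside [e], so do all nearby points, and the claim for [e] is
     vacuous there. *)
  have [ze|/existsNP[p /not_implyP[zp /negP pe]]] := pselect (supp_in (Phi z) e); last first.
    have : within D (nbhs z) [set y | Phi y p != 0].
      exact: (cvgr_neq0 _ (cP p z Dz) zp).
    by apply: filterS => y yp _ ye; case/negP: pe; exact: ye.
  pose t y := \row_(i < size e) Phi y (tnth (in_tuple e) i).
  have [zs zE] := simpl_pt_coords eu (rP z Dz) ze.
  have /NoDupP eu' := eu; have [U [Uo UE]] := Vo e eu' ec.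
  have Uz : U (t z).
    suff : (U `&` @std_simplex R (size e)) (t z) by case.
    by rewrite -UE; split => //; rewrite /preimage/= zE.
  have ct : t y @[y --> within D (nbhs z)] --> t z.
    apply: cvg_row => i; under eq_fun do rewrite mxE; rewrite mxE; exact: cP.
  have : within D (nbhs z) (t @^-1` U) := ct _ (open_nbhs_nbhs (conj Uo Uz)).
  apply: filterS => y /= Uy Dy ye _.
  have [ys yE] := simpl_pt_coords eu (rP y Dy) ye.
  have : (U `&` @std_simplex R (size e)) (t y) by [].
  by rewrite -UE => -[_]; rewrite /preimage/= yE.
have WD : within D (nbhs z) D by exact: withinT.
apply: (@filterS2 _ (within D (nbhs z)) _ _ _ _ _ WD (filter_forall _ loc)) => y Dy Vy; split=> //.
(* The face to use at [y] is the exact support of [Phi y]. *)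
have yE : [seq p <- d | Phi y p != 0] = mask [tuple of [seq Phi y p != 0 | p <- in_tuple d]] d.
  by rewrite filter_mask.
apply: (Vy [tuple of [seq Phi y p != 0 | p <- in_tuple d]]) => //; rewrite -yE.
  by move=> p yp; rewrite mem_filter yp (dP _ Dy).
have /real_ptP[_ _ yc _] := rP y Dy.
by move=> p q /InP + /InP; rewrite !mem_filter => /andP[+ _] /andP[+ _]; exact: yc.
Qed.

End OpenPreimage.

Section Maps.
Variable R : realType.

Lemma simpl_pt_fam (T : choiceType) (c : seq T) : fam (@std_simplex R (size c)) (@simpl_pt R T c).
Proof.
split; first by exists c => t _; exact: simpl_pt_supp.
move=> p; apply: cont_on_sum => i; case: asboolP => _; last exact: cont_on_cst.
exact/cont_on_continuous/coord_continuous.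
Qed.

Section Good.
Variables (T1 T2 : choiceType) (le1 : T1 -> T1 -> Prop) (le2 : T2 -> T2 -> Prop).
Implicit Types f g : (T1 -> R) -> (T2 -> R).

(* Stronger than continuity: it also asks that each closed simplex be mapped into finitely
   many closed simplices, which is what makes composites computable coordinatewise. *)
Definition good f :=
  (forall x, real_pt le1 x -> real_pt le2 (f x)) /\
  forall c, uniq c -> is_chain le1 c ->
    fam (@std_simplex R (size c)) (fun t => f (simpl_pt t)).

Lemma good_cont f : good f -> real_cont le1 le2 f.
Proof.
move=> [fr fc]; split=> // V Vo; split=> [x []//|c /NoDupP cu cc].
have sr (t : 'rV[R]_(size c)) : std_simplex t -> real_pt le1 (simpl_pt t).
  exact: simpl_pt_real.
have := fam_open_preimage (fc c cu cc) (fun t ts => fr _ (sr t ts)) Vo.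
congr rel_open; apply/seteqP; split=> t [ts tV]; split=> //.
  by split=> //; exact: sr.
by case: tV.
Qed.

(** This is why good maps compose: [f] carries the finitely many faces met by [Phi] into one finite
    support, and each coordinate of [f] is continuous for the weak topology. *)
Lemma fam_good (X : topologicalType) (D : set X) (Phi : X -> T1 -> R) f :
  (forall z, D z -> real_pt le1 (Phi z)) -> fam D Phi -> good f -> fam D (fun z => f (Phi z)).
Proof.
move=> rP fP fg; have [fr fc] := fg; have [[d' dP'] _] := fP; pose d := undup d'.
have dP z : D z -> supp_in (Phi z) d by move=> Dz p /(dP' z Dz); rewrite mem_undup.
have sub (e : seq T1) : exists s : seq T2, uniq e -> is_chain le1 e ->
    forall x, real_pt le1 x -> supp_in x e -> supp_in (f x) s.
  have [[eu ec]|H] := pselect (uniq e /\ is_chain le1 e); last first.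
    by exists [::] => eu ec; case: H.
  have [[s sP] _] := fc e eu ec; exists s => _ _ x xr xe.
  by have [ts <-] := simpl_pt_coords eu xr xe; exact: sP.
have [s sP] := choice sub; split.
  exists (flatten [seq s (mask m d) | m : (size d).-tuple bool]) => z Dz q zq.
  have zE : [seq p <- d | Phi z p != 0] = mask [tuple of [seq Phi z p != 0 | p <- in_tuple d]] d.
    by rewrite filter_mask.
  apply/flattenP; exists (s (mask [tuple of [seq Phi z p != 0 | p <- in_tuple d]] d)).
    by apply/mapP; eexists; [exact: mem_enum|].
  rewrite -zE; apply: (sP _ _ _ (Phi z)) => //; last 1 first.
  - by move=> p yp; rewrite mem_filter yp (dP _ Dz).
  - by rewrite filter_uniq ?undup_uniq.
  - have /real_ptP[_ _ yc _] := rP z Dz.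
    by move=> p p' /InP + /InP; rewrite !mem_filter => /andP[+ _] /andP[+ _]; exact: yc.
  - exact: rP.
move=> q z Dz A /nbhs_interior; rewrite -/(interior _) => nA.
(* Continuity of the coordinate [q] is tested on open sets: [V] is open in the realisation, so its
   preimage under [Phi] is relatively open. *)
pose V := [set x | real_pt le1 x /\ (interior A) (f x q)].
have Vo : real_open le1 V.
  split=> [x []//|c /NoDupP cu cc]; have [_ /(_ q) cq] := fc c cu cc.
  have := cont_on_open cq (@open_interior _ A).
  congr rel_open; apply/seteqP; split=> t [ts tV]; split=> //.
    by split=> //; exact: simpl_pt_real.
  by case: tV.
have Ro := fam_open_preimage fP rP Vo.
have SD : (D `&` Phi @^-1` V) `<=` D by move=> y [].
have := (rel_openP SD).1 Ro z (conj Dz (conj (rP z Dz) (nbhs_singleton nA))).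
by apply: filterS => y [_ [_ /interior_subset]].
Qed.

Definition goodI (H : (T1 -> R) * R -> (T2 -> R)) :=
  (forall x s, real_pt le1 x -> unit_int s -> real_pt le2 (H (x, s))) /\
  forall c, uniq c -> is_chain le1 c ->
    fam (@std_simplex R (size c) `*` @unit_int R) (fun ts => H (simpl_pt ts.1, ts.2)).

Lemma goodI_cont H : goodI H -> realI_cont le1 le2 H.
Proof.
move=> [Hr Hc]; split=> [[x s] xr su|V Vo]; first exact: Hr.
split=> [[x s] []//|c /NoDupP cu cc].
have sr ts : (@std_simplex R (size c) `*` @unit_int R) ts ->
    real_pt le2 (H (simpl_pt ts.1, ts.2)).
  by move=> [ts1 ts2]; apply: Hr => //; exact: simpl_pt_real.
have := fam_open_preimage (Hc c cu cc) sr Vo.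
congr rel_open; apply/seteqP; split=> [t [[t1 t2] tV]|t [t1 [t2 [_ tV]]]]; split=> //.
by split=> //; split=> //; split=> //=; exact: simpl_pt_real.
Qed.

Definition homotopic f g := exists H, goodI H /\
  forall x, real_pt le1 x -> H (x, 0) = f x /\ H (x, 1) = g x.

Lemma homotopic_real f g : homotopic f g -> real_homotopic le1 le2 f g.
Proof. by move=> [H [/goodI_cont Hc He]]; exists H. Qed.

Lemma unit_int1 : @unit_int R 1. Proof. by rewrite /unit_int/= lexx ler01. Qed.

Lemma good_famI f c : good f -> uniq c -> is_chain le1 c ->
  fam (@std_simplex R (size c) `*` @unit_int R) (fun ts => f (simpl_pt ts.1)).
Proof.
move=> [_ fc] cu cc.
apply: (fam_comp (h := fst) (E := @std_simplex R (size c)) _ _ (fc c cu cc)).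
  by move=> z; exact: cvg_fst.
by move=> z [].
Qed.

Lemma real_pt_segment (x y : T2 -> R) s : real_pt le2 x -> real_pt le2 y -> unit_int s ->
  (forall p q, x p != 0 \/ y p != 0 -> x q != 0 \/ y q != 0 -> le2 p q \/ le2 q p) ->
  real_pt le2 (fun p => x p * (1 - s) + y p * s).
Proof.
move=> /real_ptP[x0 [d xd] _ x1] /real_ptP[y0 [e ye] _ y1] /andP[s0 s1] xy.
have xde : supp_in (fun p => x p * (1 - s)) (d ++ e).
  by move=> p; rewrite mulf_eq0 negb_or mem_cat => /andP[/xd ->].
have yde : supp_in (fun p => y p * s) (d ++ e).
  by move=> p; rewrite mulf_eq0 negb_or mem_cat => /andP[/ye ->]; rewrite orbT.
have nz p : x p * (1 - s) + y p * s != 0 -> x p != 0 \/ y p != 0.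
  have [->|] := eqVneq (x p) 0; last by left.
  by rewrite mul0r add0r mulf_eq0 negb_or => /andP[]; right.
apply/real_ptP; split.
- by move=> p; rewrite addr_ge0// mulr_ge0// subr_ge0.
- exists (d ++ e) => p /nz[/xd|/ye]; rewrite mem_cat => ->//; by rewrite orbT.
- by move=> p q /nz + /nz; exact: xy.
- rewrite (fsumD xde yde); under eq_fun do rewrite mulrC; rewrite (fsumZ _ xd) x1.
  by under eq_fun do rewrite mulrC; rewrite (fsumZ _ ye) y1 !mulr1 subrK.
Qed.

(** The hypothesis on supports places [f x] and [g x] in a common simplex, which contains the
    segment between them. *)
Lemma homotopic_line f g : good f -> good g ->
  (forall x, real_pt le1 x -> forall p q, f x p != 0 \/ g x p != 0 ->
     f x q != 0 \/ g x q != 0 -> le2 p q \/ le2 q p) ->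
  homotopic f g.
Proof.
move=> gf gg fg; exists (fun xs p => f xs.1 p * (1 - xs.2) + g xs.1 p * xs.2).
split=> [|x xr]; last by split; apply/funext => p /=; rewrite ?subr0 ?subrr !mulr1 !mulr0 ?addr0 ?add0r.
split=> [x s xr su|c cu cc].
  by apply: real_pt_segment => //=; [exact: gf.1|exact: gg.1|exact: fg].
have cs : cont_on (@std_simplex R (size c) `*` @unit_int R) snd.
  by apply: cont_on_continuous => z; exact: cvg_snd.
apply: fam_add; apply: fam_weighted; try exact: good_famI.
  by move=> p; apply: cont_onB => //; exact: cont_on_cst.
by move=> p.
Qed.

Lemma continuous_max0 : continuous (fun s : R => Num.max 0 s).
Proof.
have := @cont_on_max0 R R setT id (cont_on_continuous (fun s => cvg_id)).
by move=> H s; have := H s Logic.I; rewrite withinET.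
Qed.

(* Since [H2 (x, 0) = H1 (x, 1)], exactly one of the two homotopies moves at any time. *)
Lemma homotopic_trans g f h : homotopic f g -> homotopic g h -> homotopic f h.
Proof.
move=> [H1 [[H1r H1c] H1e]] [H2 [[H2r H2c] H2e]].
(* Here [a] is min(1, 2s) and [b] is max(0, 2s - 1), so [H1] runs on the first half of the interval
   and [H2] on the second. *)
pose a (s : R) : R := 1 - Num.max 0 (1 - 2 * s); pose b (s : R) : R := Num.max 0 (2 * s - 1).
have ac : continuous a.
  move=> s; apply: cvgB; first exact: cvg_cst.
  apply: (@cvg_comp _ _ _ (fun s => 1 - 2 * s) _ _ (nbhs (1 - 2 * s))); last exact: continuous_max0.
  apply: cvgB; first exact: cvg_cst.
  by apply: cvgM; [exact: cvg_cst|exact: cvg_id].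
have bc : continuous b.
  move=> s; apply: (@cvg_comp _ _ _ (fun s => 2 * s - 1) _ _ (nbhs (2 * s - 1))); last exact: continuous_max0.
  apply: cvgB; last exact: cvg_cst.
  by apply: cvgM; [exact: cvg_cst|exact: cvg_id].
have au s : unit_int s -> unit_int (a s).
  by move=> /andP[s0 s1]; apply/andP; rewrite /a; case: (ltP 0 _) => h'; split; lra.
have bu s : unit_int s -> unit_int (b s).
  by move=> /andP[s0 s1]; apply/andP; rewrite /b; case: (ltP 0 _) => h'; split; lra.
(* Adding both homotopies and subtracting their common middle value glues them by one formula, whose
   coordinates are continuous without a pasting argument. *)
exists (fun xs p => H1 (xs.1, a xs.2) p + H2 (xs.1, b xs.2) p + H1 (xs.1, 1) p * -1).
have E0 x (s : R) : real_pt le1 x -> 2 * s <= 1 ->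
    (fun p => H1 (x, a s) p + H2 (x, b s) p + H1 (x, 1) p * -1) = H1 (x, a s).
  move=> xr s1; have -> : b s = 0 by rewrite /b; case: (ltP 0 _) => //; lra.
  by apply/funext => p; rewrite (H1e x xr).2 (H2e x xr).1 mulrN1 addrK.
have E1 x (s : R) : real_pt le1 x -> 1 <= 2 * s ->
    (fun p => H1 (x, a s) p + H2 (x, b s) p + H1 (x, 1) p * -1) = H2 (x, b s).
  move=> xr s1; have -> : a s = 1 by rewrite /a; case: (ltP 0 _); lra.
  by apply/funext => p; rewrite mulrN1 addrAC subrr add0r.
split; last first.
  move=> x xr /=; rewrite (E0 x 0) ?(E1 x 1) ?mulr0 ?mulr1 ?ler1n ?ler01//.
  have -> : a 0 = 0 by rewrite /a; case: (ltP 0 _); lra.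
  have -> : b 1 = 1 by rewrite /b; case: (ltP 0 _); lra.
  by rewrite (H1e x xr).1 (H2e x xr).2.
split=> [x s xr su|c cu cc] /=.
  have [s1|s1] := leP (2 * s) 1; first by rewrite E0//; apply: H1r => //; exact: au.
  by rewrite E1 ?ltW//; apply: H2r => //; exact: bu.
have pc (r : R -> R) : continuous r ->
    continuous (fun ts : 'rV[R]_(size c) * R => (ts.1, r ts.2)).
  move=> rc [t s].
  apply: (@cvg_pair _ _ _ _ (nbhs t) (nbhs (r s)) _ _ _ fst (fun ts => r ts.2)).
    exact: cvg_fst.
  by apply: (@cvg_comp _ _ _ snd _ _ (nbhs s)); [exact: cvg_snd|exact: rc].
apply: fam_add; first apply: fam_add.
- by apply: (fam_comp (pc _ ac) _ (H1c c cu cc)) => -[t s] [ts su]; split=> //; exact: au.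
- by apply: (fam_comp (pc _ bc) _ (H2c c cu cc)) => -[t s] [ts su]; split=> //; exact: bu.
- apply: fam_weighted => [|p]; last exact: cont_on_cst.
  apply: (fam_comp (pc (fun=> 1) _) _ (H1c c cu cc)); first by move=> z; exact: cvg_cst.
  by move=> -[t s] [ts su]; split=> //; exact: unit_int1.
Qed.

End Good.

Lemma good_id (T : choiceType) (le : T -> T -> Prop) : good le le id.
Proof. by split=> // c _ _; exact: simpl_pt_fam. Qed.

Section Composition.
Variables (T1 T2 T3 : choiceType).
Variables (le1 : T1 -> T1 -> Prop) (le2 : T2 -> T2 -> Prop) (le3 : T3 -> T3 -> Prop).

Lemma good_comp (f : (T1 -> R) -> T2 -> R) (g : (T2 -> R) -> T3 -> R) :
  good le1 le2 f -> good le2 le3 g -> good le1 le3 (fun x => g (f x)).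
Proof.
move=> [fr fc] gg; split=> [x xr|c cu cc]; first by apply: gg.1; exact: fr.
by apply: (fam_good (le1 := le2)) (fc c cu cc) gg => t ts; exact/fr/simpl_pt_real.
Qed.

Lemma homotopic_post (f f' : (T1 -> R) -> T2 -> R) (g : (T2 -> R) -> T3 -> R) :
  good le2 le3 g -> homotopic le1 le2 f f' -> homotopic le1 le3 (fun x => g (f x)) (fun x => g (f' x)).
Proof.
move=> gg [H [[Hr Hc] He]]; exists (fun xs => g (H xs)); split; last first.
  by move=> x /He[-> ->].
split=> [x s xr su|c cu cc]; first by apply: gg.1; exact: Hr.
apply: (fam_good (le1 := le2)) (Hc c cu cc) gg => -[t s] [ts su].
by apply: Hr => //; exact: simpl_pt_real.
Qed.

End Composition.
End Maps.

(** * Medians and superlevel sets *)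

(** Induction on the enumeration compares its head with the minimum of the rest. Reflexivity on [P]
    comes from comparability of a point with itself; reversing [r] yields maxima. *)
Lemma chain_min (T : choiceType) (r : T -> T -> Prop) (P : T -> Prop) (d : seq T) :
  (forall p q s, r p q -> r q s -> r p s) -> (forall p, P p -> p \in d) ->
  (forall p q, P p -> P q -> r p q \/ r q p) -> (exists p, P p) ->
  exists2 m, P m & forall p, P p -> r m p.
Proof.
move=> tr; elim: d P => [|a d IH] P Pd Pr [p0 P0]; first by have := Pd _ P0.
have [[q [Pq qa]]|nq] := pselect (exists q, P q /\ q != a); last first.
  have Pa q : P q -> q = a.
    by move=> Pq; apply/eqP; apply: contrapT => /negP qa; apply: nq; exists q.
  have p0a := Pa p0 P0; subst p0; exists a => // q Pq; rewrite (Pa q Pq).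
  by case: (Pr a a P0 P0).
have [|||m [Pm ma] mP] := IH (fun p => P p /\ p != a).
- by move=> p [/Pd]; rewrite in_cons => /orP[->|].
- by move=> p s [Pp _] [Ps _]; exact: Pr.
- by exists q.
have [Pa|nPa] := pselect (P a); last first.
  by exists m => // p Pp; apply: mP; split=> //; apply/eqP => pa; rewrite pa in Pp.
have raa : r a a by case: (Pr a a Pa Pa).
have [ram|rma] := Pr a m Pa Pm.
  exists a => // p Pp; have [->//|pa] := eqVneq p a.
  by apply: tr ram _; exact: mP.
by exists m => // p Pp; have [->//|pa] := eqVneq p a; exact: mP.
Qed.

Section Normalisation.
Variables (R : realType) (T : choiceType).

Lemma normalise_neq0 (x : T -> R) p : normalise x p != 0 -> x p != 0.
Proof. by rewrite mulf_eq0 negb_or => /andP[]. Qed.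

Lemma normalise_real_pt (le : T -> T -> Prop) (x : T -> R) d :
  (forall p, 0 <= x p) -> supp_in x d -> (exists p, x p != 0) ->
  (forall p q, x p != 0 -> x q != 0 -> le p q \/ le q p) ->
  real_pt le (normalise x).
Proof.
move=> x0 xd [p xp] xc; apply/real_ptP; split.
- by move=> q; rewrite divr_ge0// fsum_ge0.
- by exists d => q /normalise_neq0; exact: xd.
- by move=> q s /normalise_neq0 + /normalise_neq0; exact: xc.
- rewrite /normalise; under eq_fun do rewrite mulrC.
  by rewrite (fsumZ _ xd) mulVf// gt_eqF// (fsum_gt0 xd x0 xp).
Qed.

Lemma ler_sum_fsum (x : T -> R) (s d : seq T) :
  (forall p, 0 <= x p) -> supp_in x d -> uniq s -> \sum_(p <- s) x p <= fsum x.
Proof.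
move=> x0 xd su; rewrite (@fsumE _ _ _ (s ++ [seq p <- undup d | p \notin s])).
- by rewrite big_cat lerDl sumr_ge0.
- rewrite cat_uniq su filter_uniq ?undup_uniq// andbT /=.
  by apply/hasPn => p; rewrite mem_filter => /andP[].
- move=> p /xd pd; rewrite mem_cat mem_filter mem_undup pd andbT.
  by case: (p \in s).
Qed.

End Normalisation.

(** * Splitting a point of the realisation at its median *)

Section Halves.
Variables (R : realType) (T : choiceType).
Implicit Types (le r : T -> T -> Prop) (x : T -> R).

Definition mass_below r x p := fsum (fun q => x q * (`[< r q p >] && (q != p))%:R).

(* With [r] the order (resp. its opposite), this selects the points of the support of [x]
   lying below (resp. above) the median of [x]. *)
Definition half r x : T -> R := fun p => x p * Num.max 0 (2^-1 - mass_below r x p).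

Lemma half_supp r x p : half r x p != 0 -> x p != 0 /\ mass_below r x p < 2^-1.
Proof.
rewrite mulf_eq0 negb_or => /andP[-> h]; split=> //; move: h.
by case: (ltP 0 _) => [|_]; rewrite ?eqxx// subr_gt0.
Qed.

Variable le : T -> T -> Prop.
Hypothesis le_anti : forall p q, le p q -> le q p -> p = q.
Hypothesis le_trans : forall p q s, le p q -> le q s -> le p s.

(** If [q] lay strictly below [p], every point of the support would be strictly below [p] or
    strictly above [q]; the two masses would then add up to at least 1, while each is less than
    1/2. *)
Lemma half_lower_upper x p q : real_pt le x ->
  half le x p != 0 -> half (fun a b => le b a) x q != 0 -> le p q.
Proof.
move=> /real_ptP[x0 [d xd] xc x1] /half_supp[xp pm] /half_supp[xq qm].
have [->|pq] := eqVneq p q; first by case: (xc q q xq xq).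
case: (xc p q xp xq) => // qp; suff : 1 <= mass_below le x p + mass_below (fun a b => le b a) x q by lra.
have bd (b : T -> bool) : supp_in (fun s => x s * (b s)%:R) d.
  by move=> s; rewrite mulf_eq0 negb_or => /andP[/xd].
rewrite -x1 /mass_below -(fsumD (bd (fun s => `[< le s p >] && (s != p)))
  (bd (fun s => `[< le q s >] && (s != q)))).
apply: (ler_fsum xd) => [s|s].
  by have [->|/xd//] := eqVneq (x s) 0; rewrite !mul0r addr0 eqxx.
have [->|xs] := eqVneq (x s) 0; first by rewrite !mul0r addr0.
rewrite -mulrDr ler_peMr// -natrD ler1n addn_gt0 !lt0b.
have [->|sp] := eqVneq s p.
  by rewrite pq andbT; apply/orP; right; apply/asboolP.
case: (xc s p xs xp) => [sle|ps]; first by rewrite andbT; apply/orP; left; apply/asboolP.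
apply/orP; right; apply/andP; split; first by apply/asboolP; exact: le_trans ps.
by apply/eqP => sq; rewrite sq in ps; case/eqP: pq; exact: le_anti.
Qed.

Lemma half_good r :
  (forall p q, r p q -> r q p -> p = q) -> (forall p q s, r p q -> r q s -> r p s) ->
  (forall p q, le p q -> r p q \/ r q p) ->
  good le le (fun x => normalise (half r x)).
Proof.
move=> ranti rtrans ler.
have pos x : real_pt le x -> (forall p, 0 <= half r x p) /\ exists p, half r x p != 0.
  move=> xr; have [q xq] := real_pt_neq0 xr; have /real_ptP[x0 [d xd] xc x1] := xr.
  split=> [p|]; first by rewrite mulr_ge0// le_max lexx.
  (* The [r]-least point of the support has no mass below it, so its factor is 1/2 and the half is
     nonzero. *)
  have [||m xm mP] := @chain_min _ r (fun p => x p != 0) d rtrans xd.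
  - by move=> p s xp xs; case: (xc p s xp xs) => /ler; tauto.
  - by exists q.
  exists m; rewrite /half /mass_below /fsum fsbig1; last first.
    move=> s _; have [->|xs] := eqVneq (x s) 0; first by rewrite mul0r.
    have [//|sm] := eqVneq s m; first by rewrite andbF mulr0.
    rewrite andbT; case: asboolP => [sm'|]; last by rewrite mulr0.
    by case/eqP: sm; apply: ranti => //; exact: mP.
  by rewrite subr0 mulf_neq0.
split=> [x xr|c cu cc].
  have [h0 h1] := pos x xr; have /real_ptP[_ [d xd] xc _] := xr.
  apply: (normalise_real_pt (d := d)) => //.
    by move=> p /half_supp[/xd].
  by move=> p q /half_supp[xp _] /half_supp[xq _]; exact: xc.
apply: fam_normalise => [t ts|]; first exact/pos/simpl_pt_real.
apply: fam_weighted; first exact: simpl_pt_fam.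
move=> p; apply: cont_on_max0; apply: cont_onB; first exact: cont_on_cst.
exact/fam_fsum_weighted/simpl_pt_fam.
Qed.

End Halves.

(** * Superlevel sets of a probability vector *)

Section Levels.
Variables (R : realType) (M : choiceType) (P : {fset M} -> Prop).
Let T := {classic {Y : {fset M} | P Y}}.
Hypothesis P_neq0 : forall Y, P Y -> Y != fset0.
Implicit Types (w : M -> R) (Y : T).

(* For a probability vector [w], the factor at [y] is positive iff [w y] exceeds the mass of
   the complement of [Y]; so [Y] is a superlevel set of [w] wherever this does not vanish. *)
Definition level w : T -> R := fun Y =>
  \prod_(y <- proj1_sig Y) Num.max 0 (w y - (1 - \sum_(z <- proj1_sig Y) w z)).

Definition levels w := normalise (level w).

Lemma levels_supp w Y : levels w Y != 0 -> level w Y != 0.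
Proof. exact: normalise_neq0. Qed.

Lemma level_ge0 w Y : 0 <= level w Y.
Proof. by apply: prodr_ge0 => y _; rewrite le_max lexx. Qed.

Definition prob w := [/\ forall m, 0 <= w m, exists d, supp_in w d & fsum w = 1].

(** A nonzero factor says that [w y] exceeds the total mass outside [Y], which bounds [w z] for
    every single [z] outside. *)
Lemma level_supp w Y y : prob w -> level w Y != 0 -> y \in proj1_sig Y ->
  w y != 0 /\ forall z, z \notin proj1_sig Y -> w z < w y.
Proof.
move=> [w0 [d wd] w1]; rewrite prodf_seq_neq0 => /allP/(_ y) + yY; move=> /(_ yY) /=.
case: (ltP 0 _) => [|_]; rewrite ?eqxx// subr_gt0 => wy _; split.
  rewrite gt_eqF// (le_lt_trans _ wy)// subr_ge0 -w1.
  exact: (ler_sum_fsum w0 wd (fset_uniq _)).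
move=> z zY; apply: le_lt_trans wy; rewrite lerBrDr -w1.
have := @ler_sum_fsum _ _ w (z :: enum_fset (proj1_sig Y)) d w0 wd.
by rewrite big_cons/= zY fset_uniq => /(_ isT).
Qed.

(** Otherwise some y in [Y] only and z in [Y'] only would satisfy w z < w y < w z. *)
Lemma level_chain w Y Y' : prob w -> level w Y != 0 -> level w Y' != 0 ->
  fsubset (proj1_sig Y) (proj1_sig Y') \/ fsubset (proj1_sig Y') (proj1_sig Y).
Proof.
move=> wp YN YN'; have [|/fsubsetPn[y yY yY']] := boolP (fsubset (proj1_sig Y) (proj1_sig Y')); first by left.
right; apply/fsubsetP => z zY'; apply: contrapT => /negP zY.
have := (level_supp wp YN yY).2 z zY.
by move=> /lt_trans/(_ ((level_supp wp YN' zY').2 y yY')); rewrite ltxx.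
Qed.

Lemma sig_list (s : seq {fset M}) : exists d : seq T, forall Y, proj1_sig Y \in s -> Y \in d.
Proof.
elim: s => [|Z s [d dP]]; first by exists [::].
have [PZ|nPZ] := pselect (P Z); last first.
  exists d => Y; rewrite in_cons => /orP[/eqP YZ|/dP//].
  by case: nPZ; rewrite -YZ; exact: (proj2_sig Y).
exists (exist _ Z PZ :: d) => Y; rewrite !in_cons => /orP[/eqP YZ|/dP ->]; last by rewrite orbT.
by apply/orP; left; apply/eqP; exact: proj1_sig_inj.
Qed.

(** The full support of [w] leaves no mass outside, so each of its factors is [w y] itself. *)
Lemma level_exists w : prob w ->
  (forall Y : {fset M}, Y != fset0 -> (forall y, y \in Y -> w y != 0) -> P Y) -> exists Y, level w Y != 0.
Proof.
move=> [w0 [d wd] w1] wP; pose Y := [fset m in [seq m <- d | w m != 0]]%fset.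
have YE m : (m \in Y) = (w m != 0).
  by rewrite in_fset/= mem_filter andb_idr// => /wd.
have PY : P Y.
  apply: wP => [|y]; last by rewrite YE.
  have [m wm] : exists m, w m != 0 by apply: fsum_neq0; rewrite w1 oner_neq0.
  by apply/fset0Pn; exists m; rewrite YE.
exists (exist _ Y PY); rewrite prodf_seq_neq0; apply/allP => y /=.
rewrite -fsumE ?fset_uniq//; last by move=> m; rewrite -YE.
rewrite w1 subrr subr0 => yY; rewrite gt_eqF// lt_max ltxx /= lt_neqAle eq_sym w0 andbT.
by rewrite -YE.
Qed.

Lemma levels_real_pt w : prob w ->
  (forall Y : {fset M}, Y != fset0 -> (forall y, y \in Y -> w y != 0) -> P Y) ->
  real_pt (fun Y Y' : T => fsubset (proj1_sig Y) (proj1_sig Y')) (levels w).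
Proof.
move=> wp wP; have [w0 [d wd] w1] := wp.
have [s sP] := sig_list (fpowerset [fset m in d]%fset).
apply: (normalise_real_pt (d := s)).
- exact: level_ge0.
- move=> Y YN; apply: sP; rewrite fpowersetE; apply/fsubsetP => y yY.
  by rewrite in_fset; apply/wd; case: (level_supp wp YN yY).
- exact: level_exists.
- by move=> Y Y'; exact: level_chain.
Qed.

(** All superlevel sets are subsets of the common support [d], so its finite power set bounds the
    support of [levels]. *)
Lemma fam_levels (X : topologicalType) (D : set X) (Phi : X -> M -> R) :
  fam D Phi -> (forall z, D z -> prob (Phi z)) ->
  (forall z, D z -> forall Y : {fset M}, Y != fset0 -> (forall y, y \in Y -> Phi z y != 0) -> P Y) ->
  fam D (fun z => levels (Phi z)).
Proof.
move=> [[d dP] cP] pP PP; apply: fam_normalise => [z Dz|].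
  split; first exact: level_ge0.
  by apply: level_exists (pP z Dz) _; exact: PP.
have [s sP] := sig_list (fpowerset [fset m in d]%fset).
split.
  exists s => z Dz Y YN; apply: sP; rewrite fpowersetE; apply/fsubsetP => y yY.
  by rewrite in_fset; apply: (dP z Dz); case: (level_supp (pP z Dz) YN yY).
move=> Y; apply: cont_on_prod => y; apply: cont_on_max0; apply: cont_onB => //.
by apply: cont_onB; [exact: cont_on_cst|apply: cont_on_sum].
Qed.

Definition bary (Y : T) (y : M) : R := (y \in proj1_sig Y)%:R / #|` proj1_sig Y|%:R.

Lemma bary_ge0 Y y : 0 <= bary Y y.
Proof. by rewrite divr_ge0. Qed.

Lemma bary_supp Y y : bary Y y != 0 -> y \in proj1_sig Y.
Proof. by rewrite mulf_eq0 negb_or => /andP[]; case: (y \in _) => //; rewrite eqxx. Qed.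

Lemma bary_sum Y : fsum (bary Y) = 1.
Proof.
rewrite (fsumE (fset_uniq (proj1_sig Y)) (@bary_supp Y)) -mulr_suml big_seq.
under eq_bigr => y -> do [].
rewrite -big_seq big_const_seq count_predT iter_addr_0 divff// pnatr_eq0 cardfs_eq0.
exact/P_neq0/(proj2_sig Y).
Qed.

(** The chain of [x] has a least member [Z] containing [Y]. A point of [Z] outside [Y] would weigh
    at least as much as some point of [Y], which is impossible for a superlevel set. *)
Lemma level_bary x Y : real_pt (fun Y Y' : T => fsubset (proj1_sig Y) (proj1_sig Y')) x ->
  prob (push bary x) -> level (push bary x) Y != 0 -> x Y != 0.
Proof.
move=> /real_ptP[x0 [d xd] xc _] wp YN.
have [y0 yY0] : exists y, y \in proj1_sig Y by apply/fset0Pn/P_neq0/(proj2_sig Y).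
have cov y : y \in proj1_sig Y -> exists2 Z, x Z != 0 & y \in proj1_sig Z.
  by move=> /(level_supp wp YN)[/push_supp[Z [xZ /bary_supp yZ]] _]; exists Z.
pose sub (Z Z' : T) := fsubset (proj1_sig Z) (proj1_sig Z').
have subT Z1 Z2 Z3 : sub Z1 Z2 -> sub Z2 Z3 -> sub Z1 Z3 by exact: fsubset_trans.
(* In a chain, sets covering [Y] point by point include one containing all of [Y], namely the
   largest. *)
have big (Q : T -> Prop) : (forall Z, Q Z -> x Z != 0) ->
    (forall y, y \in proj1_sig Y -> exists2 Z, Q Z & y \in proj1_sig Z) ->
    exists2 Z, Q Z & sub Y Z.
  move=> Qx Qc; have [Z0 QZ0 _] := Qc y0 yY0.
  have [||||Z QZ Zmax] := @chain_min _ (fun a b => sub b a) Q d.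
  - by move=> a b c /[swap]; exact: subT.
  - by move=> Z /Qx /xd.
  - by move=> a b /Qx xa /Qx xb; case: (xc a b xa xb); tauto.
  - by exists Z0.
  exists Z => //; apply/fsubsetP => y /Qc[Z' /Zmax/fsubsetP]; exact.
have [Z1 xZ1 YZ1] := big (fun Z => x Z != 0) (fun _ => id) cov.
have [|||Z [xZ YZ] Zmin] := @chain_min _ sub (fun Z => x Z != 0 /\ sub Y Z) d subT.
- by move=> Z [/xd].
- by move=> a b [xa _] [xb _]; exact: xc.
- by exists Z1.
suff -> : Y = Z by [].
suff YE : proj1_sig Y = proj1_sig Z.
  exact: proj1_sig_inj.
apply/eqP; rewrite eqEfsubset; apply/andP; split; first exact: YZ.
apply/fsubsetP => z zZ; apply: contrapT => /negP zY.
(* Otherwise each point of [Y] lies in a member of the chain avoiding [z]; the largest such member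
   contains [Y] but not [z], against the minimality of [Z]. *)
have [y yY yz] : exists2 y, y \in proj1_sig Y &
    forall Z', x Z' != 0 -> y \in proj1_sig Z' -> z \in proj1_sig Z'.
  apply: contrapT => /forall2NP ny.
  have [y yY|Z' [xZ' zZ'] YZ'] := big (fun Z' => x Z' != 0 /\ z \notin proj1_sig Z') (fun _ => @proj1 _ _).
    case: (ny y) => // /existsNP[Z' /not_implyP[xZ' /not_implyP[yZ' /negP zZ']]].
    by exists Z'.
  by move/negP: zZ'; apply; apply: (fsubsetP (Zmin Z' (conj xZ' YZ'))).
have [_ /(_ z zY)] := level_supp wp YN yY; rewrite ltNge => /negP; apply.
have bd m : supp_in (fun Z' => x Z' * bary Z' m) d.
  by move=> Z'; rewrite mulf_eq0 negb_or => /andP[/xd].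
(* Termwise comparison: a member of the chain containing [y] contains [z] too, and gives both the
   same weight. *)
apply: (ler_fsum (bd y) (bd z)) => Z'; have [->|xZ'] := eqVneq (x Z') 0; first by rewrite !mul0r.
rewrite ler_wpM2l// ler_wpM2r ?invr_ge0// ler_nat.
by case: (boolP (y \in proj1_sig Z')) => // /(yz Z' xZ') ->.
Qed.

End Levels.

(** * The homotopy inverse *)

Section Indicator.
Variables (R : realType) (T T' : choiceType) (h : T -> T').

(** The Dirac kernel of [h]: pushing along it is the map of realisations induced by [h]. *)
Definition indic (p : T) (q : T') : R := (h p == q)%:R.

Lemma indic_ge0 p q : 0 <= indic p q. Proof. exact: ler0n. Qed.

Lemma indic_supp p : supp_in (indic p) [:: h p].
Proof. by move=> q; apply: contraNT; rewrite inE eq_sym /indic => /negbTE ->. Qed.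

Lemma indic_sum p : fsum (indic p) = 1.
Proof. by rewrite (fsumE _ (@indic_supp p))// big_seq1 /indic eqxx. Qed.

Lemma push_indic_supp x q : push indic x q != 0 -> exists2 p, x p != 0 & h p = q.
Proof.
by move=> /push_supp[p [xp /indic_supp]]; rewrite inE => /eqP qE; exists p.
Qed.

Lemma push_indicE x q d : supp_in x d -> uniq d ->
  push indic x q = \sum_(p <- d) (if h p == q then x p else 0).
Proof.
move=> xd du; rewrite /push (fsumE du); last first.
  by move=> p; rewrite mulf_eq0 negb_or => /andP[/xd].
by apply: eq_bigr => p _; rewrite /indic; case: eqP; rewrite ?mulr1 ?mulr0.
Qed.

End Indicator.

Lemma push_prob (R : realType) (T M : choiceType) (k : T -> M -> R) (kd : T -> seq M) x :
  (forall p q, 0 <= k p q) -> (forall p, supp_in (k p) (kd p)) -> (forall p, fsum (k p) = 1) ->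
  prob x -> prob (push k x).
Proof.
move=> k0 kP k1 [x0 [d xd] x1]; split; first exact: push_ge0.
  by exists (flatten (map kd d)); exact: push_supp_in.
by rewrite (push_sum kP k1 xd).
Qed.

Lemma real_pt_prob (R : realType) (T : choiceType) (le : T -> T -> Prop) (x : T -> R) :
  real_pt le x -> prob x.
Proof. by case/real_ptP. Qed.

Section Poset.
Variables (R : realType) (T1 T2 : choiceType) (le1 : T1 -> T1 -> Prop) (le2 : T2 -> T2 -> Prop).
Variable h : T1 -> T2.

Lemma push_indic_good : (forall p q, le1 p q -> le2 (h p) (h q)) -> good le1 le2 (push (indic R h)).
Proof.
move=> hle; split=> [x xr|c cu cc]; last first.
  exact/(fam_push (@indic_supp _ _ _ h))/simpl_pt_fam.
have /real_ptP[_ _ xc _] := xr.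
have [y0 yd y1] := push_prob (@indic_ge0 R _ _ h) (@indic_supp _ _ _ h) (@indic_sum _ _ _ h)
  (real_pt_prob xr).
apply/real_ptP; split=> // _ _ /push_indic_supp[p xp <-] /push_indic_supp[q xq <-].
by case: (xc p q xp xq) => /hle; [left|right].
Qed.

End Poset.

(* [T1] plays the role of [Sstar], [T2] of [Gstar], and [inN y N] means that [y] is a nonzero
   element of [N]; [hull] is the map [AR]. *)
Section FinsetPoset.
Variables (R : realType) (M : choiceType) (P : {fset M} -> Prop).
Let T1 := {classic {Y : {fset M} | P Y}}.
Let le1 (Y Y' : T1) := fsubset (proj1_sig Y) (proj1_sig Y').
Variables (T2 : choiceType) (le2 : T2 -> T2 -> Prop) (inN : M -> T2 -> Prop).
Hypothesis le2_anti : forall N N', le2 N N' -> le2 N' N -> N = N'.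
Hypothesis le2_trans : forall N N' N'', le2 N N' -> le2 N' N'' -> le2 N N''.
Hypothesis inN_le : forall y N N', inN y N -> le2 N N' -> inN y N'.
Hypothesis PE : forall Y, P Y <-> Y != fset0 /\ exists N, forall y, y \in Y -> inN y N.
Variables (hull : T1 -> T2) (pt : T2 -> M).
Hypothesis pt_in : forall N, inN (pt N) N.
Hypothesis hull_in : forall (Y : T1) y, y \in proj1_sig Y -> inN y (hull Y).
Hypothesis hull_min : forall (Y : T1) N, (forall y, y \in proj1_sig Y -> inN y N) -> le2 (hull Y) N.

Lemma P_fset0 Y : P Y -> Y != fset0. Proof. by case/PE. Qed.

Lemma hull_mono p q : le1 p q -> le2 (hull p) (hull q).
Proof. by move=> pq; apply: hull_min => y /(fsubsetP pq); exact: hull_in. Qed.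

Lemma real_pt_max (T : choiceType) (le : T -> T -> Prop) (x : T -> R) :
  (forall p q s, le p q -> le q s -> le p s) -> real_pt le x ->
  exists2 p, x p != 0 & forall q, x q != 0 -> le q p.
Proof.
move=> tr xr; have [q xq] := real_pt_neq0 xr; have /real_ptP[_ [d xd] xc _] := xr.
apply: (@chain_min _ (fun a b => le b a) (fun p => x p != 0) d) => //.
- by move=> a b c /[swap]; exact: tr.
- by move=> a b xa xb; case: (xc a b xa xb); tauto.
- by exists q.
Qed.

(** The form in which the rank bound is carried along: nonempty finite sets in the support of a
    confined vector satisfy [P], by [PE]. *)
Definition confined (w : M -> R) N := forall m, w m != 0 -> inN m N.

Lemma confined_P (w : M -> R) N : confined w N ->
  forall Y : {fset M}, Y != fset0 -> (forall y, y \in Y -> w y != 0) -> P Y.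
Proof. by move=> wN Y Y0 Yw; apply/PE; split=> //; exists N => y /Yw; exact: wN. Qed.

(** [F] is the realisation of AR, [V] attaches the vector w to a point over the submodule poset, [G]
    is the homotopy inverse, and [B] gives the barycentre b(x). *)
Let F := push (indic R hull).
Let V := push (indic R pt).
Let G (y : T2 -> R) : T1 -> R := levels (P := P) (V y).
Let B := push (@bary R M P).

Lemma V_prob y : prob y -> prob (V y).
Proof. exact: (push_prob (@indic_ge0 R _ _ pt) (@indic_supp _ _ _ pt) (@indic_sum _ _ _ pt)). Qed.

Lemma B_prob x : prob x -> prob (B x).
Proof. exact: (push_prob (@bary_ge0 R _ P) (@bary_supp _ _ P) (bary_sum _ P_fset0)). Qed.

Lemma V_confined y N : (forall N', y N' != 0 -> le2 N' N) -> confined (V y) N.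
Proof. by move=> yN _ /push_indic_supp[N' /yN le <-]; apply: inN_le le; exact: pt_in. Qed.

Lemma F_good : good le1 le2 F.
Proof. exact/push_indic_good/hull_mono. Qed.

Lemma V_real y : real_pt le2 y -> exists N, confined (V y) N.
Proof.
by move=> /(real_pt_max le2_trans)[N _ yN]; exists N; exact: V_confined.
Qed.

Lemma G_good : good le2 le1 G.
Proof.
split=> [y yr|c cu cc].
  have [N yN] := V_real yr; apply: levels_real_pt; first exact/V_prob/(real_pt_prob yr).
  exact: confined_P yN.
apply: fam_levels.
- exact/(fam_push (@indic_supp _ _ _ pt))/simpl_pt_fam.
- by move=> t ts; exact/V_prob/(real_pt_prob (simpl_pt_real cu cc ts)).
- by move=> t ts; have [N /confined_P] := V_real (simpl_pt_real cu cc ts).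
Qed.

Lemma confined_V_B x Y : real_pt le1 x -> (forall Z, x Z != 0 -> le1 Z Y) ->
  confined (V (F x)) (hull Y) /\ confined (B x) (hull Y).
Proof.
move=> xr Ymax; split.
  by apply: V_confined => _ /push_indic_supp[Z /Ymax/hull_mono ZY <-].
move=> m /push_supp[Z [/Ymax/fsubsetP ZY /bary_supp mZ]]; exact/hull_in/ZY.
Qed.

Lemma B_real x : real_pt le1 x -> exists N, confined (B x) N.
Proof.
move=> xr; have [Y _ Ymax] := real_pt_max (fun a b c => @fsubset_trans _ _ _ _) xr.
by exists (hull Y); case: (confined_V_B xr Ymax).
Qed.

(* On each simplex [V (F x)] and [B x] are supported in the largest submodule occurring,
   hence so is the segment between them. *)
Lemma GF_B_homotopic : homotopic le1 le1 (fun x => G (F x)) (fun x => levels (P := P) (B x)).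
Proof.
pose W (xs : (T1 -> R) * R) := fun m => V (F xs.1) m * (1 - xs.2) + B xs.1 m * xs.2.
have Wc x s : real_pt le1 x -> unit_int s -> prob (W (x, s)) /\ exists N, confined (W (x, s)) N.
  move=> xr su; have [Y _ Ymax] := real_pt_max (fun a b c => @fsubset_trans _ _ _ _) xr.
  have [VN BN] := confined_V_B xr Ymax; split; last first.
    exists (hull Y) => m; have [Vm|/VN//] := eqVneq (V (F x) m) 0.
    rewrite /W/= Vm mul0r add0r => Bm; apply: BN; apply: contraNN Bm => /eqP ->; by rewrite mul0r.
  (* For the relation that always holds, points of the realisation are just finitely supported
     probability vectors, so the segment lemma applies to vectors on [M]. *)
  have := @real_pt_segment R M (fun _ _ => True).
  have VR : real_pt (fun _ _ => True) (V (F x)).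
    by have [] := V_prob (real_pt_prob (F_good.1 x xr)) => *; apply/real_ptP; split=> // *; left.
  have BR : real_pt (fun _ _ => True) (B x).
    by have [] := B_prob (real_pt_prob xr) => *; apply/real_ptP; split=> // *; left.
  move=> /(_ _ _ s VR BR su) WR; apply: (real_pt_prob (le := fun _ _ => True)).
  by apply: WR; left.
exists (fun xs => levels (P := P) (W xs)); split; last first.
  move=> x xr; split; congr (levels (P := P) _); apply/funext => m;
    by rewrite /W/= ?subr0 ?subrr !mulr1 !mulr0 ?addr0 ?add0r.
split=> [x s xr su|c cu cc].
  by have [Wp [N /confined_P]] := Wc x s xr su; exact: levels_real_pt.
have cs : cont_on (@std_simplex R (size c) `*` @unit_int R) snd.
  by apply: cont_on_continuous => z; exact: cvg_snd.
apply: fam_levels.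
- apply: fam_add; apply: fam_weighted.
  + apply: (fam_push (@indic_supp _ _ _ pt)); exact: (good_famI F_good cu cc).
  + by move=> p; apply: cont_onB => //; exact: cont_on_cst.
  + apply: (fam_push (@bary_supp _ _ P)); exact: (good_famI (@good_id R T1 le1) cu cc).
  + by move=> p.
- by move=> [t s] [ts su]; case: (Wc _ s (simpl_pt_real cu cc ts) su).
- by move=> [t s] [ts su]; have [_ [N /confined_P]] := Wc _ s (simpl_pt_real cu cc ts) su.
Qed.

Lemma levels_B_good : good le1 le1 (fun x => levels (P := P) (B x)).
Proof.
split=> [x xr|c cu cc].
  have [N /confined_P xN] := B_real xr; exact: levels_real_pt (B_prob (real_pt_prob xr)) xN.
apply: fam_levels.
- exact/(fam_push (@bary_supp _ _ P))/simpl_pt_fam.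
- by move=> t ts; exact/B_prob/(real_pt_prob (simpl_pt_real cu cc ts)).
- by move=> t ts; have [N /confined_P] := B_real (simpl_pt_real cu cc ts).
Qed.

(** The superlevel sets of [B x] occur in the support of [x], so a straight line inside the simplex
    of [x] completes the homotopy. *)
Lemma GF_id_homotopic : homotopic le1 le1 (fun x => G (F x)) id.
Proof.
apply: (homotopic_trans GF_B_homotopic); apply: homotopic_line => [||x xr p q].
- exact: levels_B_good.
- exact: good_id.
have /real_ptP[_ _ xc _] := xr.
have sub Y : levels (P := P) (B x) Y != 0 \/ x Y != 0 -> x Y != 0.
  by case=> // /levels_supp; exact: (level_bary P_fset0 xr (B_prob (real_pt_prob xr))).
by move=> /sub xp /sub xq; exact: xc.
Qed.

(* Splitting [y] at its median as [lower y] and [upper y], the support of [F (G (lower y))]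
   lies below that of [upper y], so that two straight-line homotopies suffice after
   precomposing with [lower]. *)
Lemma FG_id_homotopic : homotopic le2 le2 (fun y => F (G y)) id.
Proof.
pose ge2 N N' := le2 N' N.
pose lower (y : T2 -> R) := normalise (half le2 y); pose upper (y : T2 -> R) := normalise (half ge2 y).
have lower_good : good le2 le2 lower by apply: half_good; [..|by left].
have upper_good : good le2 le2 upper.
  apply: half_good => [p q pq qp|p q s /[swap]|p q]; [exact: le2_anti|exact: le2_trans|by right].
have FG_good : good le2 le2 (fun y => F (G y)) := good_comp G_good F_good.
have lower_supp y N : lower y N != 0 -> y N != 0 by move=> /normalise_neq0/half_supp[].
have upper_supp y N : upper y N != 0 -> y N != 0 by move=> /normalise_neq0/half_supp[].
have h1 : homotopic le2 le2 id lower.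
  apply: homotopic_line => // [|y yr p q]; first exact: good_id.
  have /real_ptP[_ _ yc _] := yr.
  have sub N : y N != 0 \/ lower y N != 0 -> y N != 0 by case=> // /lower_supp.
  by move=> /sub yp /sub yq; exact: yc.
have h3 : homotopic le2 le2 upper id.
  apply: homotopic_line => // [|y yr p q]; first exact: good_id.
  have /real_ptP[_ _ yc _] := yr.
  have sub N : upper y N != 0 \/ y N != 0 -> y N != 0 by case=> // /upper_supp.
  by move=> /sub yp /sub yq; exact: yc.
apply: (homotopic_trans (homotopic_post FG_good h1)); apply: (homotopic_trans _ h3).
apply: homotopic_line => // [|y yr p q]; first exact: good_comp lower_good FG_good.
(* A set occurring in [G (lower y)] consists of chosen points of submodules from the lower half, all
   contained in [N']; minimality of the hull concludes. *)
have below N N' : F (G (lower y)) N != 0 -> upper y N' != 0 -> le2 N N'.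
  move=> /push_indic_supp[Y GY <-] /normalise_neq0 yq; apply: hull_min => m mY.
  have lp := real_pt_prob (lower_good.1 y yr).
  have [/push_indic_supp[N0 /normalise_neq0 yN <-] _] := level_supp (V_prob lp) (levels_supp GY) mY.
  exact: (inN_le (pt_in N0) (half_lower_upper le2_anti le2_trans yr yN yq)).
have /real_ptP[_ _ lc _] := FG_good.1 _ (lower_good.1 y yr).
have /real_ptP[_ _ uc _] := upper_good.1 y yr.
case=> [lp|up] [lq|uq]; [exact: lc|left; exact: below|right; exact: below|exact: uc].
Qed.

Lemma finset_poset_equiv : real_homotopy_equiv le1 le2 F.
Proof.
split; first exact/good_cont/F_good.
exists G; split; first exact/good_cont/G_good.
by split; apply: homotopic_real; [exact: GF_id_homotopic|exact: FG_id_homotopic].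
Qed.

End FinsetPoset.

(** * Ranks, purity and saturation *)

Section Modules.
Variables (A : idomainType) (M : lmodType A).
Implicit Types (N : set M) (l : seq M).

(** Fraction-free Gaussian elimination, by induction on the number of columns. *)
Lemma tall_matrix_kernel r k (c : 'I_k -> 'I_r -> A) : (r < k)%N ->
  exists d : 'I_k -> A, (exists i, d i != 0) /\ forall j, \sum_i d i * c i j = 0.
Proof.
elim: r k c => [|r IH] [//|k] c rk.
  by exists (fun=> 1); split; [exists ord0; exact: oner_neq0|case].
have [[i0 p0]|c0] := pselect (exists i, c i ord0 != 0); last first.
  have [d [dn dc]] := IH k.+1 (fun i j => c i (lift ord0 j)) (ltnW rk).
  exists d; split=> // j; case: (unliftP ord0 j) => [j' ->//|->].
  apply: big1 => i _; have [->|ci] := eqVneq (c i ord0) 0; first by rewrite mulr0.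
  by case: c0; exists i.
pose p := c i0 ord0.
have [d [[i1 di1] dc]] := IH k (fun i j => p * c (lift i0 i) (lift ord0 j)
  - c (lift i0 i) ord0 * c i0 (lift ord0 j)) rk.
(* The other coefficients are multiplied by the pivot to avoid division, and the coefficient of the
   pivot row is chosen to cancel the first column. *)
pose e i := if unlift i0 i is Some i' then p * d i' else - \sum_i' d i' * c (lift i0 i') ord0.
have e0 : e i0 = - \sum_i' d i' * c (lift i0 i') ord0 by rewrite /e unlift_none.
have el i : e (lift i0 i) = p * d i by rewrite /e liftK.
exists e; split; first by exists (lift i0 i1); rewrite el mulf_neq0.
move=> j; rewrite (bigD1_ord i0)//= e0; under eq_bigr do rewrite el.
case: (unliftP ord0 j) => [j' ->|->].
  rewrite -[RHS](dc j') mulNr mulr_suml -sumrN -big_split/=.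
  by apply: eq_bigr => i _; ring.
rewrite mulNr mulr_suml -sumrN -big_split/= big1// => i _; rewrite -/p; ring.
Qed.

Lemma lin_indepP l : lin_indep l <-> forall c : nat -> A,
  \sum_(i < size l) c i *: l`_i = 0 -> forall i, (i < size l)%N -> c i = 0.
Proof.
split=> [li c /li c0 i il|li c cl i]; first exact: (c0 (Ordinal il)).
pose c' k := if insub k is Some j then c j else 0.
have c'E (j : 'I_(size l)) : c' j = c j by rewrite /c' valK.
by rewrite -c'E; apply: li => //; under eq_bigr do rewrite c'E.
Qed.

(** Membership in the K-span of [l], with denominators cleared. *)
Definition dependent l (x : M) :=
  exists2 a : A, a != 0 & exists c : nat -> A, a *: x = \sum_(i < size l) c i *: l`_i.

(** In a relation on the longer list, a zero last coefficient leaves a relation on [l], and a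
    nonzero one exhibits [x] as dependent. *)
Lemma lin_indep_rcons l x : lin_indep l -> lin_indep (rcons l x) \/ dependent l x.
Proof.
move=> /lin_indepP li; have [|nd] := pselect (dependent l x); [by right|left].
apply/lin_indepP => c; rewrite size_rcons big_ord_recr /= nth_rcons ltnn eqxx.
under eq_bigr do rewrite nth_rcons ltn_ord.
have [cl|cl] := eqVneq (c (size l)) 0.
  rewrite cl scale0r addr0 => /li c0 i; rewrite ltnS leq_eqVlt => /orP[/eqP ->//|]; exact: c0.
move=> /eqP; rewrite addrC addr_eq0 => /eqP cx; case: nd; exists (c (size l)) => //.
exists (fun i => - c i); rewrite cx -sumrN; by apply: eq_bigr => i _; rewrite scaleNr.
Qed.

Lemma dependent0 l : dependent l 0.
Proof.
by exists 1; [exact: oner_neq0|exists (fun=> 0); rewrite scaler0 big1// => i _; rewrite scale0r].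
Qed.

Lemma dependentD l x y : dependent l x -> dependent l y -> dependent l (x + y).
Proof.
move=> [a a0 [c cE]] [b b0 [d dE]]; exists (a * b); first by rewrite mulf_neq0.
exists (fun i => b * c i + a * d i); rewrite scalerDr [in X in X + _]mulrC -!scalerA cE dE.
by rewrite !scaler_sumr -big_split; apply: eq_bigr => i _ /=; rewrite scalerDl !scalerA.
Qed.

Lemma dependentZ l b x : dependent l x -> dependent l (b *: x).
Proof.
move=> [a a0 [c cE]]; exists a => //; exists (fun i => b * c i).
by rewrite scalerA mulrC -scalerA cE scaler_sumr; apply: eq_bigr => i _; rewrite scalerA.
Qed.

Lemma dependent_unscale l b x : b != 0 -> dependent l (b *: x) -> dependent l x.
Proof.
move=> b0 [a a0 [c cE]]; exists (a * b); first by rewrite mulf_neq0.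
by exists c; rewrite -scalerA.
Qed.

(** The exchange bound: if [l'] were longer, a kernel vector of its coefficient matrix over [l]
    would give a nontrivial relation on [l']. *)
Lemma lin_indep_size_le l l' : lin_indep l' -> (forall x, x \in l' -> dependent l x) ->
  (size l' <= size l)%N.
Proof.
move=> li' dep; rewrite leqNgt; apply/negP => lt.
have /choice[a aP] : forall i : 'I_(size l'), exists a : A, a != 0 /\
    exists c : nat -> A, a *: l'`_i = \sum_(j < size l) c j *: l`_j.
  by move=> i; have [a a0 aE] := dep _ (mem_nth 0 (ltn_ord i)); exists a.
have /choice[c cE] := fun i => (aP i).2.
have [d [[i di] dc]] := tall_matrix_kernel (fun i (j : 'I_(size l)) => c i j) lt.
suff /eqP : d i * a i = 0 by rewrite mulf_eq0 (negbTE di) (negbTE (aP i).1).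
apply: (li' (fun i => d i * a i)).
under eq_bigr do rewrite -scalerA cE scaler_sumr.
rewrite exchange_big/= big1// => j _; under eq_bigr do rewrite scalerA.
by rewrite -scaler_suml dc scale0r.
Qed.

Lemma submodule_sum N (I : eqType) (s : seq I) (F : I -> M) : submodule N ->
  (forall i, i \in s -> N (F i)) -> N (\sum_(i <- s) F i).
Proof. by move=> [N0 [ND _]] NF; rewrite big_seq; elim/big_ind: _. Qed.

(** * Saturations and their rank *)

Section Saturation.
Implicit Types Y : {fset M}.

Lemma span_fset_submodule Y : submodule (span_fset Y).
Proof.
split; first by exists (fun=> 0); rewrite big1// => y _; rewrite scale0r.
split=> [_ _ [c ->] [d ->]|a _ [c ->]].
  by exists (fun y => c y + d y); rewrite -big_split; apply: eq_bigr => y _; rewrite scalerDl.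
by exists (fun y => a * c y); rewrite scaler_sumr; apply: eq_bigr => y _; rewrite scalerA.
Qed.

Lemma mem_span_fset Y y : y \in Y -> span_fset Y y.
Proof.
move=> yY; exists (fun z => (z == y)%:R); rewrite (bigD1_seq y) ?fset_uniq//= eqxx scale1r.
by rewrite big1 ?addr0// => z /negbTE ->; rewrite scale0r.
Qed.

Lemma saturation_pure N : submodule N -> pure (saturation N).
Proof.
move=> [N0 [ND NZ]]; split; last first.
  move=> a m a0 [b [b0 Nm]]; exists (b * a); split; first by rewrite mulf_neq0.
  by rewrite -scalerA.
split; first by exists 1; rewrite oner_neq0 scaler0.
split=> [x y [a [a0 Nx]] [b [b0 Ny]]|a x [b [b0 Nx]]].
  exists (a * b); split; first by rewrite mulf_neq0.
  rewrite scalerDr; apply: ND; first by rewrite mulrC -scalerA; exact: NZ.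
  by rewrite -scalerA; exact: NZ.
by exists b; split=> //; rewrite scalerA mulrC -scalerA; exact: NZ.
Qed.

Lemma mem_AR Y y : y \in Y -> AR Y y.
Proof. by move=> yY; exists 1; rewrite oner_neq0 scale1r; split=> //; exact: mem_span_fset. Qed.

Lemma AR_min Y N : pure N -> (forall y, y \in Y -> N y) -> AR Y `<=` N.
Proof.
move=> [Ns Np] YN m [a [a0 [c cE]]]; apply: (Np a) => //; rewrite cE.
apply: submodule_sum => // y yY; case: (Ns) => _ [_]; apply; exact: YN.
Qed.

(** All of [Y], hence all of its saturation, depends on a maximal independent list in [Y]; the
    exchange bound then applies. *)
Lemma rank_lt_AR Y n : rank_lt [set y | y \in Y] n -> rank_lt (AR Y) n.
Proof.
move=> Yn l' l'Y li'.
pose Q k := `[< exists l : seq M, [/\ {subset l <= [set y | y \in Y]}, lin_indep l & size l = k] >].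
have Q0 : exists k, Q k by exists 0%N; apply/asboolP; exists [::]; split=> // c _ [].
have Qn k : Q k -> (k <= n)%N by move=> /asboolP[l [lY li <-]]; exact/ltnW/Yn.
case: (ex_maxnP Q0 Qn) => _ /asboolP[l [lY li <-]] lmax.
apply: leq_ltn_trans (Yn l lY li); apply: lin_indep_size_le => // x /l'Y.
rewrite inE => -[a [a0 [c cE]]]; apply: (dependent_unscale a0); rewrite cE.
rewrite big_seq; elim/big_ind: _ => [||y yY]; [exact: dependent0|exact: dependentD|].
apply: dependentZ; have [liy|//] := lin_indep_rcons y li.
have /lmax : Q (size (rcons l y)).
  apply/asboolP; exists (rcons l y); split=> // z; rewrite mem_rcons in_cons => /orP[/eqP ->|/lY//].
  by rewrite inE.
by rewrite size_rcons ltnn.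
Qed.

End Saturation.

(** Append some x outside [N] to an independent list in [N]. The result is independent, so of length
    at most [n]; otherwise a nonzero multiple of x, hence by purity x itself, would lie in [N]. *)
Lemma rank_lt_pure N n : has_rank [set: M] n -> pure N -> N <> setT -> rank_lt N n.
Proof.
move=> [_ Mn] [Ns Np] NT l lN li.
have [x Nx] : exists x, ~ N x.
  by apply: contrapT => /forallNP H; apply: NT; apply/seteqP; split=> // x _; apply: contrapT.
have [lix|[a a0 [c cE]]] := lin_indep_rcons x li.
  by rewrite -(size_rcons l x); apply: Mn => // z _; rewrite inE.
case: Nx; apply: (Np a) => //; rewrite cE; apply: submodule_sum => // i _.
case: (Ns) => _ [_]; apply.
by have := lN _ (mem_nth 0 (ltn_ord i)); rewrite inE.
Qed.

Lemma Sstar_AR n (Y : {fset M}) : has_rank [set: M] n -> Sstar n Y -> Gstar (AR Y).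
Proof.
move=> [[l [lM [li ln]]] _] [/fset0Pn[y yY] [Y0 Yn]]; split.
  exact/saturation_pure/span_fset_submodule.
split=> YE.
  by have := mem_AR yY; rewrite YE /= => y0; rewrite -y0 yY in Y0.
suff : (size l < n)%N by rewrite ln ltnn.
by apply: (rank_lt_AR Yn) => // z _; rewrite YE inE.
Qed.

Lemma Gstar_neq0 N : Gstar N -> exists m, N m /\ m != 0.
Proof.
move=> [[[N0 _] _] [Nn0 _]]; apply: contrapT => /forallNP H; apply: Nn0.
apply/seteqP; split=> [m Nm|_ ->//]; apply/eqP; apply: contrapT => /negP m0.
by case: (H m).
Qed.

(** The rank condition becomes containment in a proper pure submodule, with [AR Y] as witness; this
    is the form required by the abstract poset argument. *)
Lemma SstarP n (Y : {fset M}) : has_rank [set: M] n ->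
  Sstar n Y <-> Y != fset0 /\
    exists N : {N : set M | Gstar N}, forall y, y \in Y -> proj1_sig N y /\ y != 0.
Proof.
move=> Mn; split=> [YS|[Y0 [[N [Np [_ NT]]] /= NY]]].
  split; first by case: YS.
  exists (exist _ _ (Sstar_AR Mn YS)) => y yY; split; first exact: mem_AR.
  by case: YS => _ [Y0 _]; apply: contraNneq Y0 => <-.
split=> //; split; first by apply/negP => /NY[_]; rewrite eqxx.
move=> l lY; apply: (rank_lt_pure Mn Np NT) => x /lY.
by rewrite !inE => /NY[].
Qed.

End Modules.

Theorem theorem4p2 (A : idomainType) (M : lmodType A) (n : nat) (R : realType) :
  noetherian A -> fin_gen_module M -> torsion_free M ->
  has_rank [set: M] n -> (2 <= n)%N ->
  exists F : ({Y : {fset M} | Sstar n Y} -> R) -> ({N : set M | Gstar N} -> R),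
    realises (fun Y Y' : {Y : {fset M} | Sstar n Y} => fsubset (proj1_sig Y) (proj1_sig Y'))
             (fun p q => proj1_sig q = AR (proj1_sig p)) F /\
    real_homotopy_equiv
      (fun Y Y' : {Y : {fset M} | Sstar n Y} => fsubset (proj1_sig Y) (proj1_sig Y'))
      (fun N N' : {N : set M | Gstar N} => proj1_sig N `<=` proj1_sig N')
      F.
Proof.
move=> _ _ _ Mn _.
(* The tag [{classic _}] gives these subtypes the classical choice structure that the general
   results require. *)
pose T1 := {classic {Y : {fset M} | Sstar n Y}}.
pose T2 := {classic {N : set M | Gstar N}}.
pose hull (Y : T1) : T2 := exist _ _ (Sstar_AR Mn (proj2_sig Y)).
have /choice[pt ptP] : forall N : T2, exists m, proj1_sig N m /\ m != 0.
  by move=> N; exact/Gstar_neq0/(proj2_sig N).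
exists (push (@indic R T1 T2 hull)); split.
  move=> x _ c /(@NoDupP T1) cu xc q.
  have xc' : @supp_in R T1 x c by move=> p /xc /(@InP T1).
  rewrite (push_indicE hull q xc' cu).
  apply: eq_bigr => p _; congr (if _ then _ else _).
  apply/eqP/asboolP => [<-//|qE]; exact/(@proj1_sig_inj _ _ (hull p) q)/esym.
apply: (@finset_poset_equiv R M (Sstar n) T2 (fun N N' => proj1_sig N `<=` proj1_sig N')
  (fun y N => proj1_sig N y /\ y != 0) _ _ _ _ hull pt).
- by move=> N N' NN' N'N; apply: proj1_sig_inj; apply/seteqP.
- by move=> N N' N'' h1 h2 x /h1 /h2.
- by move=> y N N' [Ny y0] /(_ y Ny).
- by move=> Y; exact: SstarP.
- exact: ptP.
- move=> Y y yY; split; first exact: mem_AR.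
  by case: (proj2_sig Y) => _ [Y0 _]; apply: contraNneq Y0 => <-.
- by move=> Y N YN; apply: AR_min => [|y /YN[]//]; case: (proj2_sig N).
Qed.
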